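(* For all distributions of $Z$ and all $n\in\mathbb{N}$, $$\mathbb{E} H_n\le\frac{2+\log n}{p_n},$$ where the right-hand side is interpreted as $+\infty$ if $p_n=0$.
   Context: $\mathbb{N}=\{1,2,\ldots\}$. Let $Z,Z_1,Z_2,\ldots$ be independent, identically distributed random variables taking values in $\mathbb{N}$; write $p_n=\mathbb{P}\{Z\ge n\}$ for $n\in\mathbb{N}$. In the subtractive random forest on vertex set $\mathbb{Z}$, integers $i\le 0$ are roots and each $n\in\mathbb{N}$ is attached by an edge to its parent $n-Z_n$. The height $H_n$ of the forest at time $n$ is the maximum over $t\in\{1,\ldots,n\}$ of the length (number of edges) of the path from $t$ to the root of its tree, i.e. the number of steps of the map $s\mapsto s-Z_s$ needed, starting from $t$, to first reach an integer $\le 0$. *)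

(* Defs.v *)
From HB Require Import structures.
From mathcomp Require Import all_boot all_order all_algebra.
From mathcomp Require Import finmap zify.
From mathcomp Require Import all_classical all_reals all_analysis.

Set Implicit Arguments.
Unset Strict Implicit.
Unset Printing Implicit Defensive.

Import Order.TTheory GRing.Theory Num.Theory.

Local Open Scope classical_set_scope.
Local Open Scope ring_scope.

Definition mutually_independent (d d' : measure_display)
    (T : measurableType d) (T' : measurableType d') (R : realType)
    (P : probability T R) (I : choiceType) (X : I -> {RV P >-> T'}) : Prop :=
  forall (J : {fset I}) (B : I -> set T'), (forall i, measurable (B i)) ->
    (P (\bigcap_(i in [set` J]) (X i @^-1` B i)) =
     \prod_(i <- J) P (X i @^-1` B i))%E.

Definition identically_distributed (d d' : measure_display)
    (T : measurableType d) (T' : measurableType d') (R : realType)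
    (P : probability T R) (I : Type) (X : I -> {RV P >-> T'}) : Prop :=
  forall (i j : I) (B : set T'), measurable B ->
    distribution P (X i) B = distribution P (X j) B.

(* The forest is built from the attachment lengths z 1, z 2, ...; z 0 is
   not used. A nonpositive integer is a root: it has no parent, and the map
   below is extended by the identity there. *)
Definition parent (z : nat -> nat) (s : int) : int :=
  if 0 < s then s - (z `|s|%N)%:Z else s.

(* The least k such that k steps from t lead to a root. If z is positive then
   each step from a positive integer decreases it, so at most t steps are
   needed and it is enough to search k in {0, ..., t}; see depth_root and
   depth_min. *)
Definition depth (z : nat -> nat) (t : nat) : nat :=
  find (fun k => iter k (parent z) t%:Z <= 0) (iota 0 t.+1).

Definition height (z : nat -> nat) (n : nat) : nat :=
  \max_(1 <= t < n.+1) depth z t.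

Lemma parent_iter_bound (z : nat -> nat) (t k : nat) :
  (forall m, (0 < m)%N -> (0 < z m)%N) ->
  iter k (parent z) t%:Z <= 0 \/ iter k (parent z) t%:Z + k%:Z <= t%:Z.
Proof.
move=> zpos; elim: k => [|k IHk]; first by right; rewrite addr0.
rewrite iterS; move: IHk; set s := iter k _ _; rewrite /parent.
case: ifP => [s0|/negbT]; last by rewrite -leNgt; left.
by have := zpos `|s|%N; lia.
Qed.

Lemma depth_root (z : nat -> nat) (t : nat) :
  (forall m, (0 < m)%N -> (0 < z m)%N) ->
  iter (depth z t) (parent z) t%:Z <= 0.
Proof.
move=> zpos; pose a k := iter k (parent z) t%:Z <= 0.
have hasa : has a (iota 0 t.+1).
  apply/hasP; exists t; first by rewrite mem_iota add0n leq0n ltnS leqnn.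
  by rewrite /a; have := @parent_iter_bound z t t zpos; lia.
have := nth_find 0%N hasa; rewrite nth_iota //.
by move: hasa; rewrite has_find size_iota.
Qed.

Lemma depth_min (z : nat -> nat) (t k : nat) :
  (k < depth z t)%N -> 0 < iter k (parent z) t%:Z.
Proof.
move=> kd; have := before_find 0%N kd.
rewrite nth_iota; first by rewrite add0n leNgt => /negbFE.
have := find_size (fun k => iter k (parent z) t%:Z <= 0) (iota 0 t.+1).
by rewrite size_iota; exact: leq_trans kd.
Qed.

(* Main.v *)
Require Import Defs.
From HB Require Import structures.
From mathcomp Require Import all_boot all_order all_algebra.
From mathcomp Require Import finmap.
From mathcomp Require Import all_classical all_reals all_analysis.
From mathcomp Require Import measurable_realfun.
From mathcomp Require Import zify ring lra.

Import Order.TTheory GRing.Theory Num.Theory.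
Local Open Scope classical_set_scope.
Local Open Scope ring_scope.

(** Write p for the probability that an attachment length is at least n, and
    q = 1 - p. A step from a vertex of {1, ..., n} with attachment length at
    least n lands on a root, so a vertex t <= n of depth more than k has its
    first k steps all shorter than n. The vertices met along the path are
    distinct, hence their attachment lengths are independent, and the depth of
    t exceeds k with probability at most q ^ k. The path is itself random, but
    the vertex it reaches is determined by the lengths at larger vertices; so
    the bound is proved by induction on k for the event intersected with
    arbitrary constraints on the lengths at larger vertices
    ([prob_unrooted]).

    A union bound over t gives P(H_n > k) <= n q ^ k. The expectation of H_n is
    the sum of these tails ([expectation_tail_sum]). The first K tails are
    bounded by 1 and the following ones by 1, q, q ^ 2, ..., as soon as
    n q ^ K <= 1, so for p > 0 the sum is at most K + 1 / p ([sum_le_geometric_tail]).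
    Since q <= exp (- p), one can take K <= 1 + log n / p
    ([exists_geometric_cutoff]), and 1 <= 1 / p absorbs the rounding. *)

Lemma expectation_tail_sum {d : measure_display} {T : measurableType d}
    {R : realType} {P : probability T R} (X : T -> nat) (N : nat) :
  (forall w, (X w <= N)%N) -> (forall k, measurable [set w | (k < X w)%N]) ->
  ('E_P[fun w => (X w)%:R : R] = \sum_(k < N) P [set w | (k < X w)%N])%E.
Proof.
move=> XN mX; rewrite unlock.
transitivity (\int[P]_w (\sum_(k < N) (\1_[set w | (k < X w)%N] w : R)%:E))%E.
  apply: eq_integral => w _; rewrite sumEFin; congr EFin.
  have -> : X w = (\sum_(k < N) (k < X w)%N)%N.
    rewrite -(subnKC (XN w)) big_split_ord /=.
    rewrite (eq_bigr (fun=> 1%N)) => [|i _]; last by rewrite ltn_ord.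
    rewrite [X in (_ + X)%N]big1 => [|i _]; last by rewrite ltnNge leq_addr.
    by rewrite sum1_card card_ord addn0.
  rewrite natr_sum; apply: eq_bigr => k _; rewrite indicE.
  by congr (nat_of_bool _)%:R; apply/idP/idP; rewrite inE.
rewrite ge0_integral_sum //; last first.
  by move=> k; exact/measurable_EFinP/measurable_indic.
by apply: eq_bigr => k _; rewrite integral_indic // setIT.
Qed.

(** The suffices-clause keeps the exact value of the truncated geometric sum,
    which is what makes the induction on N go through. *)
Lemma sum_le_geometric_tail {R : realFieldType} (p : R) (a : nat -> R)
    (N K : nat) :
  0 < p <= 1 -> (forall k, a k <= 1) ->
  (forall k, a (K + k)%N <= (1 - p) ^+ k) ->
  \sum_(k < N) a k <= K%:R + p^-1.
Proof.
move=> /andP[p0 p1] a1 aq.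
suff /le_trans : \sum_(k < N) a k <=
    (minn N K)%:R + (1 - (1 - p) ^+ (N - K)) / p.
  apply; apply: lerD; first by rewrite ler_nat geq_minr.
  by rewrite ler_piMl ?invr_ge0 ?(ltW p0) // gerBl exprn_ge0 ?subr_ge0.
elim: N => [|N IHN].
  by rewrite big_ord0 min0n sub0n expr0 subrr mul0r addr0.
rewrite big_ord_recr /=; have [NK|KN] := ltnP N K.
  have -> : minn N.+1 K = (minn N K).+1 by lia.
  have -> : (N.+1 - K = N - K)%N by lia.
  by rewrite -natr1 addrAC; exact: lerD.
have -> : minn N.+1 K = minn N K by lia.
rewrite subSn //.
apply: le_trans (lerD IHN (_ : a N <= (1 - p) ^+ (N - K))) _.
  by rewrite -{1}(subnKC KN).
by rewrite -addrA lerD2l exprS le_eqVlt; apply/orP; left; apply/eqP; field; lra.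
Qed.

(** K is the integer part of log n / p, plus 1: at least log n / p, so that
    (1 - p) ^ K <= exp (- p K) <= 1 / n, and at most log n / p + 1 / p. *)
Lemma exists_geometric_cutoff {R : realType} (n : nat) (p : R) :
  (0 < n)%N -> 0 < p <= 1 ->
  exists2 K : nat,
    n%:R * (1 - p) ^+ K <= 1 & K%:R + p^-1 <= (2 + ln n%:R) / p.
Proof.
move=> n0 /andP[p0 p1].
have n1 : 1 <= n%:R :> R by rewrite ler1n.
have nn0 : 0 < n%:R :> R by lra.
have ln0 : 0 <= ln n%:R / p :> R by rewrite divr_ge0 ?ln_ge0 // ltW.
have /andP[Kle Klt] := truncn_itv ln0.
exists (Num.trunc (ln n%:R / p)).+1; move: Kle Klt;
  set K := Num.trunc _ => Kle Klt.
  have : (1 - p) ^+ K.+1 <= n%:R^-1.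
    rewrite -(@lnK _ (n%:R)) // -expRN.
    apply: le_trans (_ : expR (- p) ^+ K.+1 <= _).
      by apply: lerXn2r; rewrite ?nnegrE ?expR_ge0 ?subr_ge0 ?expR_ge1Dx.
    rewrite -expRM_natl ler_expR mulrN lerN2 -ler_pdivrMr //.
    exact: ltW.
  by rewrite -ler_pdivlMl // mulr1.
rewrite -natr1 mulrDl.
have : 1 <= p^-1 by rewrite invf_ge1.
lra.
Qed.

Lemma iter_parent_root (z : nat -> nat) (k : nat) (x : int) :
  x <= 0 -> iter k (parent z) x = x.
Proof. by move=> x0; elim: k => //= k ->; rewrite /parent ltNge x0. Qed.

(** Vertices are shifted by one: t stands for the positive integer t.+1, so
    that t ranges over all of nat and the first n vertices are t < n. *)
Definition unrooted {T : Type} (Z : nat -> T -> nat) (k t : nat) : set T :=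
  [set w | 0 < iter k (parent (fun i => Z i w)) t.+1%:Z].

(** First-step decomposition. From t.+1, a length s.+1 <= t leads to the
    positive vertex t - s, which is numbered t - s.+1; any longer step reaches
    a root. *)
Lemma unrootedS {T : Type} (Z : nat -> T -> nat) (k t : nat)
    (Zpos : forall i w, (0 < Z i w)%N) :
  unrooted Z k.+1 t =
  \big[setU/set0]_(s < t)
    (Z t.+1 @^-1` [set s.+1] `&` unrooted Z k (t - s.+1)).
Proof.
pose A s := Z t.+1 @^-1` [set s.+1] `&` unrooted Z k (t - s.+1).
rewrite -(bigcup_mkord t A) {}/A.
apply/seteqP; split => w; rewrite /unrooted /=.
  rewrite -iterS iterSr {2}/parent /= => pos.
  have Zt : (Z t.+1 w <= t)%N.
    rewrite leqNgt; apply/negP => tZ.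
    by rewrite iter_parent_root in pos; lia.
  have Zw := Zpos t.+1 w.
  exists (Z t.+1 w).-1 => /=; first by lia.
  split; first by lia.
  by congr (is_true (0 < iter _ _ _)): pos; lia.
move=> [s /= st [Zs pos]]; rewrite -iterS iterSr {2}/parent /= Zs.
by congr (is_true (0 < iter _ _ _)): pos; lia.
Qed.

Lemma lt_depth (z : nat -> nat) (t k : nat)
    (zpos : forall m, (0 < m)%N -> (0 < z m)%N) :
  (k < depth z t)%N = (0 < iter k (parent z) t%:Z).
Proof.
apply/idP/idP => [|]; first exact: depth_min.
apply: contraTT; rewrite -leqNgt -leNgt => dk.
have := depth_root t zpos; rewrite -(subnK dk) iterD => root.
by rewrite iter_parent_root.
Qed.

Lemma lt_height (z : nat -> nat) (n k : nat) :
  (k < height z n)%N = [exists t : 'I_n, (k < depth z t.+1)%N].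
Proof.
rewrite /height big_add1 /= big_mkord; apply/idP/existsP => [|[t kt]].
  case: n => [|n]; first by rewrite big_ord0.
  have [|t ->] := @bigop.eq_bigmax 'I_n.+1 (fun i => depth z i.+1).
    by rewrite card_ord.
  by exists t.
exact: leq_trans kt (leq_bigmax t).
Qed.

Lemma height_le (z : nat -> nat) (n : nat) : (height z n <= n.+1)%N.
Proof.
rewrite /height big_seq_cond; apply/bigmax_leqP_seq => t.
rewrite mem_index_iota andbT => tn _.
have := find_size (fun k => iter k (parent z) t%:Z <= 0) (iota 0 t.+1).
by rewrite size_iota -/(depth z t); lia.
Qed.

Lemma measurable_preimage_nat {d : measure_display} {T : measurableType d}
    (X : {mfun T >-> nat}) (A : set nat) :
  measurable (X @^-1` A).
Proof. by rewrite -[X in measurable X]setTI; exact: measurable_funPT. Qed.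

Lemma unrooted_measurable {d : measure_display} {T : measurableType d}
    {R : realType} {P : probability T R} (Z : nat -> {RV P >-> nat})
    (Zpos : forall i w, (0 < Z i w)%N) (k t : nat) :
  measurable (unrooted Z k t).
Proof.
elim: k t => [|k IHk] t.
  by rewrite [X in measurable X](_ : _ = setT) //; apply/seteqP; split.
rewrite unrootedS //; apply: bigsetU_measurable => s _.
apply: measurableI => //.
exact: measurable_preimage_nat.
Qed.

(** The constraints B on the lengths at the vertices of J, all larger than
    t.+1, are carried along so that the induction needs independence only in
    its product form: each step of the path moves its starting vertex, with
    the prescribed length, into J. *)
Lemma prob_unrooted {d : measure_display} {T : measurableType d}
    {R : realType} {P : probability T R} (Z : nat -> {RV P >-> nat})
    (Zpos : forall i w, (0 < Z i w)%N)
    (Zindep : mutually_independent Z) (Zid : identically_distributed Z)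
    (n k t : nat) (J : {fset nat}) (B : nat -> set nat)
    (tn : (t < n)%N) (tJ : forall j, j \in J -> (t.+1 < j)%N) :
  (P (\bigcap_(i in [set` J]) (Z i @^-1` B i) `&` unrooted Z k t) <=
   (\prod_(i <- J) P (Z i @^-1` B i)) * P [set w | (Z 0 w < n)%N] ^+ k)%E.
Proof.
have mZ i A := measurable_preimage_nat (Z i) A.
have mJ (K : {fset nat}) C :
    measurable (\bigcap_(i in [set` K]) (Z i @^-1` C i)).
  exact: fin_bigcap_measurable.
elim: k t J B tn tJ => [|k IHk] t J B tn tJ.
  rewrite expe0 mule1 -Zindep //; apply: le_measure; rewrite ?inE //.
  by apply: measurableI => //; exact: unrooted_measurable.
set q := P _ in IHk *; set p := (\prod_(i <- J) _)%E.
rewrite unrootedS // expeS muleCA big_distrr /=.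
pose A s := \bigcap_(i in [set` J]) (Z i @^-1` B i) `&`
  (Z t.+1 @^-1` [set s.+1] `&` unrooted Z k (t - s.+1)).
apply: le_trans (@Boole_inequality _ _ _ P A t _) _ => [s _|].
  by do 2 (apply: measurableI => //); exact: unrooted_measurable.
(* The constraint C s also prescribes a first step of length s.+1. *)
pose C s i := if i == t.+1 then [set s.+1] else B i.
have tJ' : t.+1 \notin J by apply/negP => /tJ; rewrite ltnn.
have step (s : 'I_t) : (P (\bigcap_(i in [set` J]) (Z i @^-1` B i) `&`
      (Z t.+1 @^-1` [set s.+1] `&` unrooted Z k (t - s.+1))) <=
    P (Z 0%N @^-1` [set s.+1]) * (p * q ^+ k))%E.
  have -> : (P (Z 0%N @^-1` [set s.+1]) = P (Z t.+1 @^-1` [set s.+1]))%E.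
    exact: Zid.
  rewrite muleA; have := IHk (t - s.+1)%N (t.+1 |` J)%fset (C s).
  rewrite big_fsetU1 //= {2}/C eqxx.
  have -> : (\prod_(i <- J) P (Z i @^-1` C s i) = p)%E.
    rewrite /p !big_seq; apply: eq_bigr => i iJ; rewrite /C.
    by case: eqP iJ => // ->; rewrite (negbTE tJ').
  have -> : \bigcap_(i in [set` (t.+1 |` J)%fset]) (Z i @^-1` C s i) =
      \bigcap_(i in [set` J]) (Z i @^-1` B i) `&` Z t.+1 @^-1` [set s.+1].
    apply/seteqP; split => w /=.
      move=> h; split; last first.
        by have := h t.+1; rewrite /= /C eqxx; apply; rewrite in_fset1U eqxx.
      move=> i /= iJ; have := h i; rewrite /= /C in_fset1U iJ orbT => /(_ isT).
      by case: eqP iJ => // ->; rewrite (negbTE tJ').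
    move=> [h Zt] i /=; rewrite in_fset1U /C; case: eqP => [->//|_ /= iJ].
    exact: h.
  rewrite setIA; apply; first by have := ltn_ord s; lia.
  move=> j; have st := ltn_ord s; rewrite in_fset1U => /orP[/eqP ->|/tJ]; lia.
apply: le_trans (lee_sum _ (fun s _ => step s)) _.
have p0 : (0 <= p)%E by apply: prode_ge0.
have q0 : (0 <= q)%E by exact: measure_ge0.
rewrite -ge0_sume_distrl; last by move=> s _; exact: measure_ge0.
apply: lee_wpmul2r => //.
  by rewrite mule_ge0 // expe_ge0.
rewrite -(@measure_bigsetU _ _ _ P (fun s => Z 0%N @^-1` [set s.+1])) //.
- apply: le_measure; rewrite ?inE //; first exact: bigsetU_measurable.
    exact: (mZ 0%N [set i | (i < n)%N]).
  rewrite -(bigcup_mkord t (fun s => Z 0%N @^-1` [set s.+1])).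
  by move=> w [s /= st ->]; lia.
- by move=> i j _ _ [w [/= -> [->]]].
Qed.

(* Z 0 is the generic copy of the law; Z 1, Z 2, ... are the attachment
   lengths of the forest. Division in \bar R satisfies 0^-1 = +oo, so the
   right-hand side is +oo when the probability is 0. *)
Theorem proposition7 (d : measure_display) (T : measurableType d)
    (R : realType) (P : probability T R) (Z : nat -> {RV P >-> nat})
    (Zpos : forall i w, (0 < Z i w)%N)
    (Zindep : mutually_independent Z)
    (Zid : identically_distributed Z)
    (n : nat) (n_gt0 : (0 < n)%N) :
  ('E_P[fun w => (height (fun i => Z i w) n)%:R : R] <=
   (2 + ln n%:R)%:E / P [set w | (n <= Z 0 w)%N])%E.
Proof.
have mA : measurable [set w | (n <= Z 0%N w)%N].
  exact: (measurable_preimage_nat (Z 0%N) [set i | (n <= i)%N]).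
have ln0 : 0 <= ln n%:R :> R by rewrite ln_ge0 // ler1n.
have mU := unrooted_measurable Z Zpos.
have tailE k : [set w | (k < height (fun i => Z i w) n)%N] =
    \big[setU/set0]_(t < n) unrooted Z k t.
  rewrite -bigcup_mkord; apply/seteqP; split => w /=; rewrite lt_height.
    move=> /existsP[t]; rewrite lt_depth // => kt.
    by exists t => /=.
  by move=> [t /= tn kt]; apply/existsP; exists (Ordinal tn); rewrite lt_depth.
have mtail k : measurable [set w | (k < height (fun i => Z i w) n)%N].
  by rewrite tailE; exact: bigsetU_measurable.
rewrite (expectation_tail_sum _ _ (fun w => height_le (fun i => Z i w) n)) //.
set pE := P _.
have [p0|p0] := eqVneq pE 0%E.
  by rewrite p0 inve0 gt0_muley ?leey // lte_fin; lra.
have pfin : pE \is a fin_num by exact: fin_num_measure.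
have [p pp] : exists p, pE = p%:E by exists (fine pE); rewrite fineK.
have p01 : 0 < p <= 1.
  rewrite -!lee_fin -lte_fin -pp probability_le1 // andbT.
  by rewrite lt0e p0 measure_ge0.
have [K nK Kp] := exists_geometric_cutoff _ _ n_gt0 p01.
have tail k : (P [set w | (k < height (fun i => Z i w) n)%N] <=
    (n%:R * (1 - p) ^+ k)%:E)%E.
  rewrite tailE; apply: le_trans (Boole_inequality _ _) _ => //.
  have -> : n%:R * (1 - p) ^+ k = \sum_(t < n) (1 - p) ^+ k.
    by rewrite sumr_const card_ord mulr_natl.
  rewrite -sumEFin; apply: lee_sum => t _.
  (* No constraint is imposed on larger vertices: J is empty. *)
  have := @prob_unrooted _ _ _ _ Z Zpos Zindep Zid n k t fset0 (fun=> setT)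
    (ltn_ord t).
  rewrite big_seq_fset0 mul1e.
  have -> : \bigcap_(i in [set` fset0]) (Z i @^-1` setT) = setT.
    by apply/seteqP; split.
  have -> : [set w | (Z 0%N w < n)%N] = ~` [set w | (n <= Z 0%N w)%N].
    by apply/seteqP; split => w /=; rewrite ltnNge => /negP.
  rewrite setTI probability_setC // -/pE pp EFin_expe; apply.
  by move=> j; rewrite in_fset0.
have /andP[p_gt0 p_le1] := p01.
rewrite pp inver gt_eqF //.
pose a k := fine (P [set w | (k < height (fun i => Z i w) n)%N]).
rewrite (eq_bigr (fun k => (a (nat_of_ord k))%:E)) => [|k _]; last first.
  by rewrite fineK ?fin_num_measure.
rewrite sumEFin -EFinM lee_fin; apply: le_trans Kp.
apply: sum_le_geometric_tail => // k.
  by rewrite -lee_fin fineK ?fin_num_measure ?probability_le1.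
rewrite -lee_fin fineK ?fin_num_measure //; apply: le_trans (tail _) _.
rewrite lee_fin exprD mulrA ler_piMl ?exprn_ge0 // ; lra.
Qed.
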